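(* Let $r$ be an integer with $r>0$. For $N\in\mathbb{N}$ let $$K_{r,N}(z,z')=e^{-\frac{\pi}{2}(|z|^2+|z'|^2)}\sum_{j=0}^{N-1}H_{j,r}(z,\overline{z})\,\overline{H_{j,r}(z',\overline{z'})},\qquad z,z'\in\mathbb{C},$$ and let $\rho_{r,N}(z)=K_{r,N}(z,z)$. Then $$\rho_{r,N}\Big(\sqrt{\tfrac{N}{\pi}}\,\cdot\Big)\longrightarrow 1_{\mathbb{D}}\quad\text{in } L^1(\mathbb{R}^2)\text{ as } N\to\infty,$$ where $\mathbb{D}$ is the unit disk. Moreover there is a constant $C_r$ (depending only on $r$) such that for all $N$, $$\big\|\rho_{r,N}-1_{\mathbb{D}_{\sqrt{N/\pi}}}\big\|_{L^1(\mathbb{R}^2)}\le C_r\sqrt{N},$$ where $\mathbb{D}_{\rho}$ denotes the disk of radius $\rho$ centered at the origin.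
   Context: $\mathbb{C}$ is identified with $\mathbb{R}^2$. The Laguerre polynomials are $L_j^{\alpha}(x)=\sum_{i=0}^{j}(-1)^i\binom{j+\alpha}{j-i}\frac{x^i}{i!}$ for $j\ge0$, $j+\alpha\ge0$. The complex Hermite polynomials are, for $j,r\ge 0$, $H_{j,r}(z,\overline z)=\sqrt{\frac{r!}{j!}}\pi^{\frac{j-r}{2}}z^{j-r}L_r^{j-r}(\pi|z|^2)$ if $j>r$, and $H_{j,r}(z,\overline z)=(-1)^{r-j}\sqrt{\frac{j!}{r!}}\pi^{\frac{r-j}{2}}\overline{z}^{\,r-j}L_j^{r-j}(\pi|z|^2)$ if $j\le r$. The function $K_{r,N}$ is the correlation kernel of the finite $(r,N)$-pure polyanalytic Ginibre ensemble and $\rho_{r,N}$ its one-point intensity. *)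

(* Defs.v *)
(* C is identified with R^2 via
   (x, y) |-> x +i* y, with R : realType and complex numbers R[i]. *)
From mathcomp Require Import all_boot all_algebra.
From mathcomp Require Import all_classical all_reals all_analysis.
From mathcomp Require Import complex.
Import GRing.Theory Num.Theory.
Local Open Scope ring_scope.

Set Implicit Arguments.
Unset Strict Implicit.
Unset Printing Implicit Defensive.

Section Defs.
Variable R : realType.

(* Generalized Laguerre polynomial L_n^a(x) = sum_{i=0}^n (-1)^i C(n+a, n-i) x^i / i!
   (only needed for natural a >= 0, which is the case in H_{j,r}). *)
Definition laguerre (n a : nat) (x : R) : R :=
  \sum_(i < n.+1) (-1) ^+ i * ('C(n + a, n - i))%:R * x ^+ i / (i`!)%:R.

(* |z|^2 for z in C = R^2 *)
Definition sqnorm (z : R[i]) : R := complex.Re z ^+ 2 + complex.Im z ^+ 2.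

(* complex Hermite polynomial H_{j,r}(z, zbar) *)
Definition cHermite (j r : nat) (z : R[i]) : R[i] :=
  if (r < j)%N then
    ((Num.sqrt ((r`!)%:R / (j`!)%:R) * Num.sqrt pi ^+ (j - r)
       * laguerre r (j - r) (pi * sqnorm z))%:C * z ^+ (j - r))%C
  else
    (((-1) ^+ (r - j) * Num.sqrt ((j`!)%:R / (r`!)%:R) * Num.sqrt pi ^+ (r - j)
       * laguerre j (r - j) (pi * sqnorm z))%:C * (z^*)%C ^+ (r - j))%C.

(* correlation kernel of the finite (r,N)-pure polyanalytic Ginibre ensemble *)
Definition K_rN (r N : nat) (z z' : R[i]) : R[i] :=
  ((expR (- (pi / 2) * (sqnorm z + sqnorm z')))%:C *
   \sum_(j < N) cHermite j r z * (cHermite j r z')^*)%C.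

(* one-point intensity rho_{r,N}(z) = K_{r,N}(z,z)  (a real number; we take
   its real part, the imaginary part being 0) *)
Definition rho_rN (r N : nat) (z : R[i]) : R := complex.Re (K_rN r N z z).

(* the point of C corresponding to p in R^2 *)
Definition toC (p : R * R) : R[i] := (p.1 +i* p.2)%C.

(* open disk of radius s centered at the origin, as a subset of R^2 *)
Definition disk (s : R) : set (R * R) := [set p | p.1 ^+ 2 + p.2 ^+ 2 < s ^+ 2].

(* Lebesgue measure on R^2 *)
Definition leb2 := (@lebesgue_measure R \x @lebesgue_measure R)%E.

End Defs.

(* Main.v *)
(* Put [x = pi |z|^2]. In this variable the planar Lebesgue measure is [dx] on
   [0, +oo[, the squared modulus of [H_{j,r}], weighted by [e^{-x}], is a density
   [f_{r,j}] (the distribution of a matrix element of a displacement operator),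
   and [rho_{r,N}] becomes [phi_N = \sum_(j < N) f_{r,j}].
   - Unitarity gives [phi_N <= 1], and each [f_{r,j}] has mass 1, so the
     distance of [phi_N] to the indicator of [0, N[ is twice its mass beyond [N].
   - [f_{r,j} - f_{r,j+1}] and [phi_N'] are explicit products of neighbouring
     matrix elements: the first fact makes [f_{r,j}] the derivative of an
     explicit tail, the second turns the mass of [phi_N] beyond [N] into the
     integral of [- (x - N) phi_N'], that is, essentially the mean deviation
     from [N] under [f_{r,N-1}] and [f_{r,N}].
   - Multiplication by [x] is tridiagonal on matrix elements, so these densities
     have mean [j + r + 1] and variance [O(N)]; the deviation is [O(sqrt N)]. *)
Require Import Defs.
From mathcomp Require Import all_boot all_order all_algebra.
From mathcomp Require Import all_classical all_reals all_analysis.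
From mathcomp Require Import complex measurable_realfun ring lra zify.
Import Order.TTheory GRing.Theory Num.Theory.
Import numFieldNormedType.Exports.
Local Open Scope classical_set_scope.
Local Open Scope ring_scope.

Set Implicit Arguments.
Unset Strict Implicit.
Unset Printing Implicit Defensive.

(** * Recurrences for the coefficients of G_r = (w - t)^r e^{t w} *)

Section HermiteCoefficients.
Variable R : realType.
Implicit Types (r j N : nat) (t : R).

(* The coefficient of [w^j] in [(w - t)^r e^{t w}], as a polynomial in [t]. *)
Definition hcoef r j : {poly R} :=
  \sum_(i < j.+1) ('C(r, j - i)%:R / i`!%:R) *: ((- 'X) ^+ (r - (j - i)) * 'X^i).

Lemma hcoef0 j : hcoef 0 j = j`!%:R^-1 *: 'X^j.
Proof.
rewrite /hcoef big_ord_recr big1 /= ?add0r => [|i _].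
  by rewrite subnn bin0 expr0 !mul1r.
by rewrite -(subnSK (ltn_ord i)) bin0n mul0r scale0r.
Qed.

Lemma hcoefn0 r : hcoef r 0 = (- 'X) ^+ r.
Proof.
by rewrite /hcoef big_ord1 !subn0 bin0 fact0 divr1 expr0 mulr1 scale1r.
Qed.

Lemma hcoefS0 r : hcoef r.+1 0 = - 'X * hcoef r 0.
Proof. by rewrite !hcoefn0 exprS. Qed.

(** Coefficient of w^{j+1} in G_{r+1} = (w - t) G_r. *)
Lemma hcoefSS r j : hcoef r.+1 j.+1 = hcoef r j - 'X * hcoef r j.+1.
Proof.
rewrite /hcoef big_ord_recr [X in _ - _ * X]big_ord_recr /= mulrDr opprD addrA.
rewrite mulr_sumr -sumrB; congr +%R; last first.
  rewrite subnn !bin0 !subn0 -scalerAr.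
  by rewrite -[in RHS]scalerN exprS !mulNr mulrA.
apply: eq_bigr => i _; rewrite subSn -1?ltnS// binS subSS.
rewrite natrD mulrDl scalerDl addrC; congr +%R.
rewrite -scalerAr -scalerN; case: (leqP (j - i).+1 r) => h; last first.
  by rewrite bin_small// mul0r !scale0r.
by congr (_ *: _); rewrite -(subnSK h) exprS !mulNr mulrA.
Qed.

(** The factor [r] makes both sides vanish at [r = 0], where [r.-1] is not a true predecessor. *)
Lemma mulr_hcoef r j :
  r%:R * hcoef r j.+1 = r%:R * (hcoef r.-1 j - 'X * hcoef r.-1 j.+1).
Proof. by case: r => [|r]; rewrite ?mul0r// hcoefSS. Qed.

(** Coefficient of w^j in the derivative of G_r with respect to w. *)
Lemma hcoefSn r j : j.+1%:R * hcoef r j.+1 = r%:R * hcoef r.-1 j + 'X * hcoef r j.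
Proof.
elim: r j => [|r IH] j.
  rewrite mul0r add0r !hcoef0 -!scalerAr -exprS -polyC_natr mul_polyC scalerA.
  by rewrite factS natrM invfM mulrAC mulVf ?mul1r// pnatr_eq0.
elim: j => [|j _] /=.
  have := IH 0; rewrite hcoefSS !hcoefn0 !mul1r => ->.
  case: r {IH} => [|r] /=; first by rewrite !expr0; ring.
  by rewrite !exprS; ring.
have e1 := IH j; have e2 := IH j.+1; rewrite !hcoefSS.
apply/eqP; rewrite -subr_eq0; apply/eqP.
transitivity (j.+1%:R * hcoef r j.+1 - 'X * (j.+2%:R * hcoef r j.+2)
   - r%:R * hcoef r j.+1 - 'X * (hcoef r j - 'X * hcoef r j.+1)); first by ring.
by rewrite e1 e2 mulr_hcoef; ring.
Qed.

(** Differentiation of G_r in t: the exponential brings down w, which shifts j, and the power brings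
    down -r. *)
Lemma deriv_hcoef r j : (hcoef r j)^`() =
  (if j is k.+1 then hcoef r k else 0) - r%:R * hcoef r.-1 j.
Proof.
elim: r j => [|r IH] j.
  rewrite mul0r subr0; case: j => [|j]; rewrite !hcoef0 derivZ derivXn.
    by rewrite mulr0n scaler0.
  rewrite -scalerMnr scalerMnl -mulr_natl factS natrM invfM mulrA divff.
    by rewrite mul1r.
  by rewrite pnatr_eq0.
case: j => [|j].
  rewrite !hcoefn0 deriv_exp derivN derivX /= -mulr_natl.
  by ring.
rewrite hcoefSS derivB derivM derivX mul1r !IH /=.
have -> : r.+1%:R * hcoef r j.+1 = r%:R * hcoef r j.+1 + hcoef r j.+1 by ring.
rewrite mulr_hcoef; case: j => [|j].
  by rewrite hcoefS0; ring.
by rewrite hcoefSS; ring.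
Qed.

(** Coefficient of w^j in (w - t) dG_r/dw = (r + t (w - t)) G_r: a relation in j alone, with r
    fixed. *)
Lemma hcoef_rec r j :
  'X * (if j is k.+1 then hcoef r k else 0) + j.+1%:R * 'X * hcoef r j.+1 =
  (j%:R - r%:R + 'X ^+ 2) * hcoef r j.
Proof.
rewrite mulrAC mulrC hcoefSn.
case: j => [|j].
  case: r => [|r]; first by rewrite !hcoefn0; ring.
  by rewrite !hcoefn0 /= exprS; ring.
have -> : (j.+1%:R - r%:R + 'X^2) * hcoef r j.+1 =
  j.+1%:R * hcoef r j.+1 - r%:R * hcoef r j.+1 + 'X^2 * hcoef r j.+1 by ring.
by rewrite hcoefSn mulr_hcoef; ring.
Qed.

(** Together with [derivX_hcoefS], this expresses the derivatives of two neighbours through these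
    neighbours only, as needed to differentiate the products in [htail]. *)
Lemma derivX_hcoef r j :
  'X * (hcoef r j)^`() =
  (j%:R - r%:R + 2 * 'X^2) * hcoef r j - 2 * j.+1%:R * 'X * hcoef r j.+1.
Proof.
have e := hcoef_rec r j; have e' := hcoefSn r j.
rewrite deriv_hcoef.
have -> : r%:R * hcoef r.-1 j = j.+1%:R * hcoef r j.+1 - 'X * hcoef r j.
  by rewrite e'; ring.
rewrite mulrBr.
have -> : 'X * (if j is k.+1 then hcoef r k else 0) =
  (j%:R - r%:R + 'X ^+ 2) * hcoef r j - j.+1%:R * 'X * hcoef r j.+1.
  by rewrite -e; ring.
by ring.
Qed.

Lemma derivX_hcoefS r j :
  'X * (hcoef r j.+1)^`() = 2 * 'X * hcoef r j - (j.+1%:R - r%:R) * hcoef r j.+1.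
Proof.
rewrite derivX_hcoef.
have := hcoef_rec r j.+1 => e.
have -> : 2 * j.+2%:R * 'X * hcoef r j.+2 =
  2 * ((j.+1%:R - r%:R + 'X ^+ 2) * hcoef r j.+1 - 'X * hcoef r j).
  by rewrite -e; ring.
by ring.
Qed.

(** The tridiagonal action of x = t^2: it moves (r, j) along the diagonal, and the centring j + r +
    1 is the mean of the density. *)
Lemma hcoef_mulX2 r j :
  ('X ^+ 2 - (j + r + 1)%:R) * hcoef r j =
  - (j.+1%:R * hcoef r.+1 j.+1) - r%:R * (if j is k.+1 then hcoef r.-1 k else 0).
Proof.
rewrite hcoefSS mulrBr.
have -> : j.+1%:R * ('X * hcoef r j.+1) = 'X * (j.+1%:R * hcoef r j.+1) by ring.
rewrite hcoefSn !natrD.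
have e3 : r%:R * hcoef r j =
    r%:R * ((if j is k.+1 then hcoef r.-1 k else 0) - 'X * hcoef r.-1 j).
  case: (r) => [|k]; rewrite ?mul0r//; congr (_ * _) => /=.
  by case: (j) => [|i]; rewrite ?hcoefSS// !hcoefn0 exprS; ring.
have -> : ('X^2 - (j%:R + r%:R + 1)) * hcoef r j =
  ('X^2 - (j%:R + 1)) * hcoef r j - r%:R * hcoef r j by ring.
rewrite e3 -[j.+1%:R]natr1; move: (if j is k.+1 then hcoef r.-1 k else 0).
by move: (hcoef r.-1 j) (hcoef r j) (j%:R) (r%:R) => u v a b m; ring.
Qed.

End HermiteCoefficients.

(** * Polynomials times a Gaussian: decay at infinity and positivity *)

Section GaussianPolynomials.
Variable R : realType.
Implicit Types (p q : {poly R}) (t : R).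

(* [(p e^{-t^2})' = gderiv p e^{-t^2}] *)
Definition gderiv p := p^`() - 2 * 'X * p.

Lemma horner_gderiv p t : (gderiv p).[t] = p^`().[t] - 2 * t * p.[t].
Proof. by rewrite hornerD hornerN !hornerM hornerX -polyC_natr hornerC. Qed.

Lemma gderivD p q : gderiv (p + q) = gderiv p + gderiv q.
Proof. by rewrite /gderiv derivD; ring. Qed.

Lemma gderivZ (a : R) p : gderiv (a *: p) = a *: gderiv p.
Proof. by rewrite /gderiv derivZ scalerBr scalerAr. Qed.

Lemma gderiv_sum (I : Type) (s : seq I) (F : I -> {poly R}) :
  gderiv (\sum_(i <- s) F i) = \sum_(i <- s) gderiv (F i).
Proof.
elim/big_ind2: _ => //; first by rewrite /gderiv deriv0 mulr0 subr0.
by move=> p1 q1 p2 q2 <- <-; rewrite gderivD.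
Qed.

Lemma is_derive_gauss_poly p t :
  is_derive t 1 (fun x => p.[x] * gauss_fun x) ((gderiv p).[t] * gauss_fun t).
Proof.
have dg : is_derive t 1 (@gauss_fun R) (- (2 * t) * gauss_fun t).
  rewrite /gauss_fun; apply: trigger_derive.
  by rewrite /GRing.scale /= ?mulr1; ring.
apply: trigger_derive.
by rewrite /gderiv !hornerE /GRing.scale /=; ring.
Qed.

Lemma cvg_gauss_monom n : t ^+ n * gauss_fun t @[t --> +oo] --> (0 : R).
Proof.
(* For t >= 1, e^{t^2} >= e^t >= t^{n+1} / (n+1)!. *)
apply: (@squeeze_cvgr _ _ _ _ (fun=> 0) (fun t : R => n.+1`!%:R * t^-1)).
- near=> t; have t1 : 1 <= t by near: t; exact: nbhs_pinfty_ge.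
  have t0 : 0 < t by exact: lt_le_trans t1.
  rewrite mulr_ge0 ?exprn_ge0 ?gauss_fun_ge0 ?(ltW t0)//=.
  rewrite -[X in X <= _](mulfK (lt0r_neq0 t0)) ler_pM2r ?invr_gt0//.
  rewrite mulrAC -exprSr /gauss_fun expRN -ler_pdivlMr ?invr_gt0 ?expR_gt0//.
  rewrite invrK mulrC -ler_pdivrMr ?ltr0n ?fact_gt0//.
  apply: (@le_trans _ _ (expR t)).
    by apply: le_trans (expR_ge1Dxn n (ltW t0)); rewrite lerDr.
  by rewrite ler_expR expr2 ler_peMr// ltW.
- exact: cvg_cst.
- rewrite -(mulr0 n.+1`!%:R); apply: cvgM; first exact: cvg_cst.
  apply/gtr0_cvgV0; last exact: cvg_id.
  by near=> t; near: t; exact: nbhs_pinfty_gt.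
Unshelve. all: by end_near. Qed.

Lemma cvg_gauss_poly p : p.[t] * gauss_fun t @[t --> +oo] --> (0 : R).
Proof.
(* The extra monomial absorbs the factor ['X] in the induction on p. *)
suff H n : t ^+ n * (p.[t] * gauss_fun t) @[t --> +oo] --> (0 : R).
  by have := H 0; under eq_fun do rewrite expr0 mul1r.
elim/poly_ind: p n => [|p c IH] n.
  under eq_fun do rewrite horner0 mul0r mulr0.
  exact: cvg_cst.
have -> : (fun t => t ^+ n * ((p * 'X + c%:P).[t] * gauss_fun t)) =
   (fun t => t ^+ n.+1 * (p.[t] * gauss_fun t) + c * (t ^+ n * gauss_fun t)).
  by apply/funext => t; rewrite hornerMXaddC exprS; ring.
rewrite -(addr0 0) -[X in _ --> _ + X](mulr0 c).
apply: cvgD; first exact: IH.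
by apply: cvgM; [exact: cvg_cst|exact: cvg_gauss_monom].
Qed.

Lemma gauss_poly_nincr p (a : R) :
  (forall t, a <= t -> (gderiv p).[t] <= 0) ->
  forall x y, a <= x -> x <= y -> p.[y] * gauss_fun y <= p.[x] * gauss_fun x.
Proof.
move=> H; apply: ler0_derive1_nincry.
- by move=> x _; exact: ex_derive.
- move=> x; rewrite in_itv/= andbT => ax.
  rewrite derive1E (@derive_val _ _ _ _ _ _ _ (is_derive_gauss_poly p x)).
  by rewrite mulr_le0_ge0 ?gauss_fun_ge0// H// ltW.
- apply: continuous_subspaceT => x.
  by apply/differentiable_continuous/derivable1_diffP; exact: ex_derive.
Qed.

(** p e^{-t^2} decreases on [a, +oo[ to its limit 0. This replaces integration over [a, +oo[: an
    inequality between tails follows from a pointwise one between their derivatives. *)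
Lemma gauss_poly_ge0 p (a : R) :
  (forall t, a <= t -> (gderiv p).[t] <= 0) -> 0 <= p.[a].
Proof.
move=> H; rewrite -(pmulr_lge0 _ (expR_gt0 (- a ^+ 2))) -/(gauss_fun a).
rewrite -(cvg_lim _ (cvg_gauss_poly p))//.
apply: limr_le; first by apply/cvg_ex; exists 0; exact: cvg_gauss_poly.
near=> t; apply: (gauss_poly_nincr H); first exact: lexx.
by near: t; apply: nbhs_pinfty_ge; exact: num_real.
Unshelve. all: by end_near. Qed.

End GaussianPolynomials.

(** * Densities, their tails and their partial sums *)

Section Densities.
Variable R : realType.
Implicit Types (r j N : nat) (t : R).

(** The squared modulus of H_{j,r} at pi |z|^2 = t^2, see [cHermite_sqr]; the Gaussian weight is
    kept apart so that the algebra stays polynomial. *)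
Definition hdens r j : {poly R} := (j`!%:R / r`!%:R) *: hcoef R r j ^+ 2.

(* [htail r j] at [t], times [e^{-t^2}], is the integral of the density
   [hdens r j] (at [sqrt x], times [e^{-x}]) over [x >= t^2]. *)
Definition htail r j : {poly R} :=
  \sum_(i < r.+1) i`!%:R^-1 *: 'X^(i.*2) +
  \sum_(i < j) (i`!%:R / r`!%:R) *: ('X * hcoef R r i * hcoef R r i.+1).

Definition hsum r N : {poly R} := \sum_(j < N) hdens r j.

Lemma hdens_ge0 r j t : 0 <= (hdens r j).[t].
Proof. by rewrite hornerZ horner_exp mulr_ge0 ?divr_ge0 ?ler0n ?sqr_ge0. Qed.

Lemma hsum_ge0 r N t : 0 <= (hsum r N).[t].
Proof. by rewrite horner_sum sumr_ge0// => j _; exact: hdens_ge0. Qed.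

Lemma hdensS_scale r j :
  hdens r j.+1 = (j`!%:R / r`!%:R) *: (j.+1%:R * hcoef R r j.+1 ^+ 2).
Proof.
rewrite /hdens factS natrM -polyC_natr mul_polyC scalerA; congr (_ *: _).
by ring.
Qed.

(** The factor 2t is that of dx = 2t dt. For j = 0 the density is x^r e^{-x} / r!, whose tail is a
    truncated exponential series times e^{-x}; each further summand of [htail] differentiates to the
    difference of two consecutive densities. *)
Lemma gderiv_htail r j : gderiv (htail r j) = - (2 * 'X * hdens r j).
Proof.
rewrite gderivD; elim: j => [|j IH].
  rewrite big_ord0 gderiv_sum [gderiv 0]/gderiv deriv0 mulr0 subr0 addr0.
  rewrite /hdens fact0 hcoefn0 -exprM.
  have -> : (- 'X : {poly R}) ^+ (r * 2) = 'X^(r.*2).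
    by rewrite mulnC exprM sqrrN -exprM mul2n.
  elim: r => [|r IH].
    by rewrite big_ord1 gderivZ /gderiv derivXn mulr0n -!mul_polyC; ring.
  rewrite big_ord_recr /= IH gderivZ /gderiv derivXn doubleS.
  rewrite factS natrM !mul1r invfM -!mul_polyC.
  have e : (r.+1%:R^-1%:P * r.+1%:R = 1 :> {poly R}).
    by rewrite -polyC_natr -polyCM mulVf ?pnatr_eq0.
  have -> : 'X^(r.*2.+1) *+ r.*2.+2 = 2 * r.+1%:R * 'X^(r.*2.+1) :> {poly R}.
    by rewrite -mulr_natl -natrM mul2n doubleS.
  rewrite /= !polyCM !exprS.
  transitivity (2 * 'X * (r`!%:R^-1)%:P * 'X^(r.*2) * (r.+1%:R^-1%:P * r.+1%:R - 1) -
     2 * 'X * (r.+1%:R^-1%:P * (r`!%:R^-1)%:P * ('X * ('X * 'X^(r.*2)))) : {poly R}).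
    by ring.
  by rewrite e; ring.
rewrite [X in _ + gderiv X]big_ord_recr /= gderivD addrA IH gderivZ hdensS_scale.
have -> : gderiv ('X * hcoef R r j * hcoef R r j.+1) =
   2 * 'X * (hcoef R r j ^+ 2 - j.+1%:R * hcoef R r j.+1 ^+ 2).
  rewrite /gderiv !derivM derivX.
  transitivity (hcoef R r j * hcoef R r j.+1 + ('X * (hcoef R r j)^`()) * hcoef R r j.+1
    + hcoef R r j * ('X * (hcoef R r j.+1)^`())
    - 2 * 'X * ('X * hcoef R r j * hcoef R r j.+1)).
    by ring.
  by rewrite derivX_hcoef derivX_hcoefS; ring.
by rewrite /hdens -!mul_polyC; ring.
Qed.

Lemma horner_gderiv_htail r j t :
  (gderiv (htail r j)).[t] = - (2 * t * (hdens r j).[t]).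
Proof. by rewrite gderiv_htail hornerN !hornerM hornerX -polyC_natr hornerC. Qed.

(** Every density has mass 1. *)
Lemma htail0 r j : (htail r j).[0] = 1.
Proof.
rewrite hornerD !horner_sum big_ord_recl !big1 => [|i _|i _].
- by rewrite hornerZ hornerXn fact0 invr1 mul1r expr0 !addr0.
- by rewrite hornerZ !hornerM hornerX !mul0r mulr0.
- by rewrite hornerZ hornerXn /= /bump /= add1n doubleS exprS mul0r mulr0.
Qed.

Lemma htail_ge0 r j t : 0 <= t -> 0 <= (htail r j).[t].
Proof.
move=> t0; apply: gauss_poly_ge0 => x tx.
rewrite horner_gderiv_htail oppr_le0 mulr_ge0 ?hdens_ge0//.
by rewrite mulr_ge0// (le_trans t0).
Qed.

Lemma htail_le1 r j t : 0 <= t -> (htail r j).[t] * gauss_fun t <= 1.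
Proof.
move=> t0; have -> : 1 = (htail r j).[0] * gauss_fun 0 :> R.
  by rewrite htail0 /gauss_fun expr0n /= oppr0 expR0 mulr1.
apply: (gauss_poly_nincr (a := 0)) => // x x0.
rewrite horner_gderiv_htail oppr_le0 mulr_ge0 ?hdens_ge0//.
by rewrite mulr_ge0.
Qed.

(** The derivative of each density is a difference of neighbouring products, so the sum telescopes
    to one product at the edge N. *)
Lemma gderiv_hsum r N :
  gderiv (hsum r N.+1) =
  - ((2 * N.+1`!%:R / r`!%:R) *: (hcoef R r N * hcoef R r N.+1)).
Proof.
have D k : (hcoef R r k)^`() =
    (if k is i.+1 then hcoef R r i else 0) - k.+1%:R * hcoef R r k.+1
    + 'X * hcoef R r k.
  by rewrite deriv_hcoef hcoefSn; ring.
rewrite /hsum; elim: N => [|N IH].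
  rewrite big_ord1 /hdens gderivZ /gderiv deriv_exp D//= -!mul_polyC.
  by rewrite !polyCM !fact0 polyC_natr; ring.
rewrite big_ord_recr gderivD IH /= hdensS_scale gderivZ.
rewrite /gderiv derivM -polyC_natr derivC deriv_exp D//= -!mul_polyC !polyC_natr.
rewrite [N.+2`!]factS [N.+1`!]factS !natrM !polyCM !polyC_natr expr1.
by ring.
Qed.

End Densities.

(** * The bound by 1, the deviation from N, and the O(sqrt N) tail *)

Section Bounds.
Variable R : realType.
Implicit Types (r j N : nat) (t : R).

Local Notation dens r j t := ((hdens R r j).[t] * gauss_fun t).
Local Notation phi r N t := ((hsum R r N).[t] * gauss_fun t).

Lemma divr_fact_succ (a : R) r : a / r`!%:R = a / r.+1`!%:R * r.+1%:R.
Proof.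
rewrite factS natrM invfM -mulrA [X in _ = _ * X]mulrAC mulVf ?mul1r//.
Qed.

Lemma hsumS r N : hsum R r N.+1 = hsum R r N + hdens R r N.
Proof. by rewrite /hsum big_ord_recr. Qed.

(** By the recurrences, [hdens r.+1 j.+1] and [hdens r j] differ by a telescoping boundary term.
    This carries the bound by 1 from r to r + 1. *)
Lemma hsum_shift r N : hsum R r.+1 N.+1 =
  hsum R r N - (N`!%:R / r.+1`!%:R) *: ('X * hcoef R r N * hcoef R r.+1 N).
Proof.
elim: N => [|N IH].
  rewrite /hsum big_ord1 big_ord0 sub0r -scalerN /hdens; congr (_ *: _).
  by rewrite hcoefS0; ring.
rewrite hsumS IH hsumS hdensS_scale -addrA; set b := N`!%:R / _.
have -> : hdens R r N = b *: (r.+1%:R * hcoef R r N ^+ 2).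
  by rewrite -polyC_natr mul_polyC scalerA -divr_fact_succ.
have -> : N.+1`!%:R / r.+1`!%:R = b * N.+1%:R by rewrite factS natrM /b; ring.
rewrite -addrA; congr (_ + _); rewrite -[in RHS]scalerA -!scalerN -!scalerDr.
congr (_ *: _); rewrite -[X in _ = _ + X]mul_polyC polyC_natr.
have e := hcoefSn R r.+1 N; have e' := hcoefSS R r N; rewrite /= in e.
have -> : r.+1%:R * hcoef R r N ^+ 2 =
   hcoef R r N * (N.+1%:R * hcoef R r.+1 N.+1 - 'X * hcoef R r.+1 N).
  by rewrite e; ring.
have -> : hcoef R r N = hcoef R r.+1 N.+1 + 'X * hcoef R r N.+1.
  by rewrite e'; ring.
by ring.
Qed.

Lemma dens_ge0 r j t : 0 <= dens r j t.
Proof. by rewrite mulr_ge0 ?hdens_ge0 ?gauss_fun_ge0. Qed.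

Lemma phiS r N t : phi r N.+1 t = phi r N t + dens r N t.
Proof. by rewrite hsumS hornerD mulrDl. Qed.

Lemma phi_ge0 r N t : 0 <= phi r N t.
Proof. by rewrite mulr_ge0 ?hsum_ge0 ?gauss_fun_ge0. Qed.

Lemma phi_homo r t : {homo (fun N => phi r N t) : M N / (M <= N)%N >-> M <= N}.
Proof.
by apply: (homo_leq (@lexx _ _) (@le_trans _ _)) => N; rewrite phiS lerDl dens_ge0.
Qed.

(** The boundary term of [hsum_shift] is split by 2ab <= a^2 + b^2 into two densities of index N,
    which are terms of summable series in N. *)
Lemma phi_shift_le r N t :
  phi r.+1 N.+1 t <= phi r N t + (t ^+ 2 * dens r N t + dens r.+1 N t) / 2.
Proof.
have g0 := gauss_fun_ge0 t.
rewrite [t ^+ 2 * _]mulrA -!mulrDl mulrAC -mulrDl ler_wpM2r//.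
rewrite hsum_shift hornerD hornerN hornerZ !hornerM hornerX.
rewrite /hdens !hornerZ !horner_exp.
set b := N`!%:R / r.+1`!%:R.
have -> : N`!%:R / r`!%:R = b * r.+1%:R :> R.
  exact: divr_fact_succ.
set u := (hcoef R r N).[t]; set v := (hcoef R r.+1 N).[t].
rewrite lerD2l -subr_ge0.
have -> : (t ^+ 2 * (b * r.+1%:R * u ^+ 2) + b * v ^+ 2) / 2 - - (b * (t * u * v))
  = b / 2 * ((t * u + v) ^+ 2 + r%:R * (t * u) ^+ 2).
  by rewrite -[r.+1%:R]natr1; field.
rewrite mulr_ge0 ?divr_ge0 ?ler0n ?addr_ge0 ?sqr_ge0//.
by rewrite mulr_ge0 ?sqr_ge0.
Qed.

(* An excess [eta] of the partial sum over 1 would, by [phi_shift_le], bound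
   from below all later terms of two convergent series. *)
Lemma phi_le1 r N t : phi r N t <= 1.
Proof.
elim: r N => [|r IH] N.
  apply: le_trans (phi_homo 0 t (leqnSn N)) _.
  (* For r = 0 both are the truncated exponential series in t^2; it is even, so [htail_le1] can be
     used at |t|. *)
  rewrite (_ : hsum R 0 N.+1 = htail R N 0).
    rewrite -[X in _ * X](_ : gauss_fun `|t| = _).
      have -> : (htail R N 0).[t] = (htail R N 0).[`|t|].
        rewrite /htail big_ord0 addr0 !horner_sum; apply: eq_bigr => i _.
        by rewrite !hornerZ !hornerXn -mul2n !exprM real_normK ?num_real.
      exact: htail_le1.
    by rewrite /gauss_fun real_normK ?num_real.
  rewrite /hsum /htail big_ord0 addr0; apply: eq_bigr => i _.
  rewrite /hdens hcoef0 exprZn scalerA fact0 divr1 -exprM muln2; congr (_ *: _).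
  by rewrite expr2 mulrA divff ?mul1r// pnatr_eq0 -lt0n fact_gt0.
(* A crude bound first: [phi_shift_le] gives phi <= 1 + (t^2 + phi) / 2, and phi is absorbed on the
   left. *)
have B M : phi r.+1 M t <= 2 + t ^+ 2.
  apply: le_trans (phi_homo r.+1 t (leqnSn M)) _.
  have h1 := phi_shift_le r M t; have h2 := IH M.
  have h3 : t ^+ 2 * dens r M t <= t ^+ 2 * 1.
    apply: ler_wpM2l; first exact: sqr_ge0.
    by apply: le_trans (IH M.+1); rewrite phiS lerDr phi_ge0.
  have h4 : dens r.+1 M t <= phi r.+1 M.+1 t by rewrite phiS lerDr phi_ge0.
  move: h1 h2 h3 h4; move: (phi r.+1 M.+1 t) (phi r M t) (dens r.+1 M t).
  by move: (t ^+ 2 * dens r M t) (t ^+ 2) => *; lra.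
rewrite leNgt; apply/negP => lt1.
have [eta etaE eta0] : exists2 eta, phi r.+1 N t = 1 + eta & 0 < eta.
  by exists (phi r.+1 N t - 1); rewrite ?subr_gt0// addrC subrK.
(* By monotonicity the sum stays above 1 + eta, so [phi_shift_le] forces t^2 f_{r,M} + f_{r+1,M} >=
   2 eta for each M >= N; these are added up. *)
have L n : 2 * eta * n%:R <= t ^+ 2 * phi r (N + n) t + phi r.+1 (N + n) t.
  elim: n => [|n IHn].
    by rewrite mulr0 addr_ge0 ?phi_ge0// mulr_ge0 ?sqr_ge0 ?phi_ge0.
  have h1 := phi_shift_le r (N + n) t; have h2 := IH (N + n)%N.
  have h3 := phi_homo r.+1 t (leqW (leq_addr n N)); rewrite /= in h3.
  rewrite addnS [phi r _.+1 t]phiS [phi r.+1 _.+1 t]phiS -[n.+1%:R]natr1 !mulrDr mulr1.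
  move: IHn h1 h2 h3; rewrite etaE; move: (phi r.+1 (N + n).+1 t) => b.
  by move: (t ^+ 2 * phi r _ t) (t ^+ 2 * dens r _ t) (2 * eta * n%:R) => *; lra.
(* The right side of [L] is at most t^2 + (2 + t^2), by the induction hypothesis and [B]. *)
have [n hn] : exists n, (2 * t ^+ 2 + 2) < (2 * eta) * n%:R.
  have e0 : 0 < 2 * eta by rewrite mulr_gt0.
  exists (Num.bound ((2 * eta)^-1 * (2 * t ^+ 2 + 2))).
  rewrite -ltr_pdivrMl//; apply: archi_boundP.
  by rewrite mulr_ge0 ?invr_ge0 ?(ltW e0)// addr_ge0// mulr_ge0 ?sqr_ge0.
have h := le_trans (ltW hn) (L n).
have h5 := B (N + n)%N; have h6 : t ^+ 2 * phi r (N + n) t <= t ^+ 2 * 1.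
  by apply: ler_wpM2l; [exact: sqr_ge0|exact: IH].
have := lt_le_trans hn (L n); move: h5 h6.
by move: (t ^+ 2) => *; lra.
Qed.

(** The square of [hcoef_mulX2], with (a + b)^2 <= 2a^2 + 2b^2: a pointwise variance bound, since
    all densities have mass 1. The predecessors at 0 are harmless because their coefficient [j * r]
    vanishes. *)
Lemma hdens_var r j t :
  (t ^+ 2 - (j + r + 1)%:R) ^+ 2 * (hdens R r j).[t] <=
  2 * (j.+1%:R * r.+1%:R) * (hdens R r.+1 j.+1).[t] +
  2 * (j%:R * r%:R) * (hdens R r.-1 j.-1).[t].
Proof.
rewrite /hdens !hornerZ !horner_exp.
have := congr1 (fun p => p.[t]) (hcoef_mulX2 R r j).
rewrite hornerM !hornerD !hornerN !hornerM -!polyC_natr !hornerC hornerX -expr2.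
set c := (hcoef R r j).[t]; set u := (hcoef R r.+1 j.+1).[t].
set v := (X in _ - r%:R * X) => e.
have -> : (t ^+ 2 - (j + r + 1)%:R) ^+ 2 * (j`!%:R / r`!%:R * c ^+ 2) =
  j`!%:R / r`!%:R * (j.+1%:R * u + r%:R * v) ^+ 2.
  rewrite mulrCA -exprMn e; ring.
have -> : 2 * (j.+1%:R * r.+1%:R) * (j.+1`!%:R / r.+1`!%:R * u ^+ 2) =
  j`!%:R / r`!%:R * (2 * (j.+1%:R * u) ^+ 2).
  rewrite (divr_fact_succ _ r) factS natrM; ring.
have -> : 2 * (j%:R * r%:R) * (j.-1`!%:R / r.-1`!%:R * (hcoef R r.-1 j.-1).[t] ^+ 2) =
  j`!%:R / r`!%:R * (2 * (r%:R * v) ^+ 2).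
  rewrite /v; case: (j) => [|k] /=.
    by rewrite horner0 !(mulr0, mul0r, expr0n).
  case: (r) => [|q] /=; first by rewrite !(mulr0, mul0r, expr0n).
  rewrite (divr_fact_succ k`!%:R q) [k.+1`!]factS natrM; ring.
rewrite -mulrDr ler_wpM2l ?divr_ge0// -subr_ge0.
have -> : 2 * (j.+1%:R * u) ^+ 2 + 2 * (r%:R * v) ^+ 2 - (j.+1%:R * u + r%:R * v) ^+ 2
  = (j.+1%:R * u - r%:R * v) ^+ 2 by ring.
exact: sqr_ge0.
Qed.

(** Recentring from the mean j + r + 1 to N costs at most r + 1, since j is N - 1 or N. *)
Lemma hdens_dev r j N t : (0 < N)%N -> (N <= j.+1 <= N.+1)%N ->
  (t ^+ 2 - N%:R) ^+ 2 * (hdens R r j).[t] <=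
  8 * r.+1%:R ^+ 2 * N%:R *
   ((hdens R r.+1 j.+1).[t] + (hdens R r.-1 j.-1).[t] + (hdens R r j).[t]).
Proof.
move=> N0 jN; have := hdens_var r j t.
move: (hdens_ge0 r j t) (hdens_ge0 r.+1 j.+1 t) (hdens_ge0 r.-1 j.-1 t).
move: (hdens R r j).[t] (hdens R r.+1 j.+1).[t] (hdens R r.-1 j.-1).[t].
move=> d u v d0 u0 v0 h.
set m := (j + r + 1)%:R in h.
have hm : (m - N%:R) ^+ 2 <= r.+1%:R ^+ 2 :> R.
  rewrite ler_pXn2r ?nnegrE// ?subr_ge0; first by rewrite lerBlDr -natrD ler_nat; lia.
  by rewrite ler_nat; lia.
have N1 : 1 <= N%:R :> R by rewrite ler1n.
have h1 : (t ^+ 2 - N%:R) ^+ 2 <= 2 * (t ^+ 2 - m) ^+ 2 + 2 * r.+1%:R ^+ 2.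
  apply: (@le_trans _ _ (2 * (t ^+ 2 - m) ^+ 2 + 2 * (m - N%:R) ^+ 2)); last first.
    by rewrite lerD2l ler_pM2l.
  rewrite -subr_ge0.
  have -> : 2 * (t ^+ 2 - m) ^+ 2 + 2 * (m - N%:R) ^+ 2 - (t ^+ 2 - N%:R) ^+ 2 =
     (t ^+ 2 - m - (m - N%:R)) ^+ 2 by ring.
  exact: sqr_ge0.
apply: (le_trans (ler_wpM2r d0 h1)).
have -> : (2 * (t ^+ 2 - m) ^+ 2 + 2 * r.+1%:R ^+ 2) * d =
  2 * ((t ^+ 2 - m) ^+ 2 * d) + 2 * r.+1%:R ^+ 2 * d by ring.
apply: (@le_trans _ _ (2 * (2 * (j.+1%:R * r.+1%:R) * u + 2 * (j%:R * r%:R) * v)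
   + 2 * r.+1%:R ^+ 2 * d)); first by rewrite lerD2r ler_pM2l.
have k1 : 4 * (j.+1%:R * r.+1%:R) * u <= 8 * r.+1%:R ^+ 2 * N%:R * u.
  apply: ler_wpM2r => //; rewrite -!natrM -natrX -!natrM ler_nat; nia.
have k2 : 4 * (j%:R * r%:R) * v <= 8 * r.+1%:R ^+ 2 * N%:R * v.
  apply: ler_wpM2r => //; rewrite -!natrM -natrX -!natrM ler_nat; nia.
have k3 : 2 * r.+1%:R ^+ 2 * d <= 8 * r.+1%:R ^+ 2 * N%:R * d.
  apply: ler_wpM2r => //; rewrite -natrX -!natrM ler_nat; nia.
rewrite !mulrDr.
have -> : 2 * (2 * (j.+1%:R * r.+1%:R) * u) = 4 * (j.+1%:R * r.+1%:R) * u by ring.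
have -> : 2 * (2 * (j%:R * r%:R) * v) = 4 * (j%:R * r%:R) * v by ring.
by apply: lerD => //; apply: lerD.
Qed.

(** From second to first moment by 2 s y <= s^2 + y^2 with s = sqrt N; the constant 5 is (2 + 8) /
    2. *)
Lemma hdens_absdev r j N t : (0 < N)%N -> (N <= j.+1 <= N.+1)%N ->
  (t ^+ 2 - N%:R) * (hdens R r j).[t] <=
  5 * r.+1%:R ^+ 2 * Num.sqrt N%:R *
   ((hdens R r.+1 j.+1).[t] + (hdens R r.-1 j.-1).[t] + (hdens R r j).[t]).
Proof.
move=> N0 jN; have := hdens_dev r t N0 jN.
move: (hdens_ge0 r j t) (hdens_ge0 r.+1 j.+1 t) (hdens_ge0 r.-1 j.-1 t).
move: (hdens R r j).[t] (hdens R r.+1 j.+1).[t] (hdens R r.-1 j.-1).[t].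
move=> d u v d0 u0 v0.
have s0 : 0 < Num.sqrt N%:R :> R by rewrite sqrtr_gt0 ltr0n.
have : N%:R = Num.sqrt N%:R ^+ 2 :> R by rewrite sqr_sqrtr.
move: (Num.sqrt N%:R) s0 => s s0 -> ; set y := t ^+ 2 - _ => h.
rewrite -(ler_pM2l (mulr_gt0 (ltr0n R 2) s0)).
have hy : 2 * s * y <= s ^+ 2 + y ^+ 2.
  by rewrite -subr_ge0 (_ : _ - _ = (s - y) ^+ 2) ?sqr_ge0//; ring.
rewrite mulrA; apply: (le_trans (ler_wpM2r d0 hy)); rewrite mulrDl.
have h1 : s ^+ 2 * d <= 2 * r.+1%:R ^+ 2 * s ^+ 2 * (u + v + d).
  have -> : 2 * r.+1%:R ^+ 2 * s ^+ 2 * (u + v + d) =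
    s ^+ 2 * (2 * r.+1%:R ^+ 2 * (u + v + d)) by ring.
  rewrite ler_wpM2l ?sqr_ge0//.
  have r1 : 1 <= r.+1%:R ^+ 2 :> R by rewrite expr_ge1// ler1n.
  apply: (@le_trans _ _ (1 * (u + v + d))); first by rewrite mul1r lerDr addr_ge0.
  by rewrite ler_wpM2r ?addr_ge0//; lra.
apply: le_trans (lerD h1 h) _.
by rewrite le_eqVlt; apply/orP; left; apply/eqP; ring.
Qed.

(* Tails of the six densities on the right-hand sides of [hdens_absdev] for
   [j = n] and [j = n.+1]. *)
Definition htail_nearby r n : {poly R} :=
  (htail R r.+1 n.+1 + htail R r.-1 n.-1 + htail R r n) +
  (htail R r.+1 n.+2 + htail R r.-1 n + htail R r n.+1).

Lemma horner_gderiv_htail_nearby r n t : (gderiv (htail_nearby r n)).[t] =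
  - (2 * t * ((hdens R r.+1 n.+1).[t] + (hdens R r.-1 n.-1).[t] + (hdens R r n).[t] +
   ((hdens R r.+1 n.+2).[t] + (hdens R r.-1 n).[t] + (hdens R r n.+1).[t]))).
Proof.
have D (a b c d e f : {poly R}) : (gderiv (a + b + c + (d + e + f))).[t] =
    (gderiv a).[t] + (gderiv b).[t] + (gderiv c).[t] +
    ((gderiv d).[t] + (gderiv e).[t] + (gderiv f).[t]).
  by rewrite !horner_gderiv !derivD !hornerD; ring.
by rewrite /htail_nearby D !horner_gderiv_htail; ring.
Qed.

(** The edge product in [gderiv_hsum] is at most t times the sum of the densities n and n + 1; the
    weight t^2 - (n + 1) is then absorbed by [hdens_absdev], leaving the derivative of a sum of
    tails. *)
Lemma hsum_drift r n t : Num.sqrt n.+1%:R <= t ->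
  (t ^+ 2 - n.+1%:R) * - (gderiv (hsum R r n.+1)).[t] <=
  - (5 * r.+1%:R ^+ 2 * Num.sqrt n.+1%:R) * (gderiv (htail_nearby r n)).[t] / 2.
Proof.
move=> st; set s := Num.sqrt _ in st *.
have s0 : 0 < s by rewrite sqrtr_gt0 ltr0n.
have t0 : 0 < t by exact: lt_le_trans st.
have sE : s ^+ 2 = n.+1%:R by rewrite sqr_sqrtr.
have y0 : 0 <= t ^+ 2 - n.+1%:R.
  by rewrite subr_ge0 -sE ler_pXn2r// nnegrE ltW.
have h1 := hdens_absdev r t (ltn0Sn n) (_ : (n.+1 <= n.+1 <= n.+2)%N).
have h2 := hdens_absdev r t (ltn0Sn n) (_ : (n.+1 <= n.+2 <= n.+2)%N).
have {h1}h1 := h1 ltac:(lia); have {h2}h2 := h2 ltac:(lia).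
have h3 : - (gderiv (hsum R r n.+1)).[t] <=
    t * ((hdens R r n).[t] + (hdens R r n.+1).[t]).
  rewrite gderiv_hsum hdensS_scale /hdens hornerN !hornerZ !hornerM.
  rewrite -!polyC_natr !hornerC opprK factS natrM.
  set a := (hcoef R r n).[t]; set b := (hcoef R r n.+1).[t].
  set q := n`!%:R / r`!%:R.
  have -> : 2 * (n.+1%:R * n`!%:R) / r`!%:R * (a * b) = q * (2 * n.+1%:R * a * b).
    by rewrite /q; ring.
  rewrite -mulrDr [leRHS]mulrCA ler_wpM2l ?divr_ge0// -sE -subr_ge0.
  (* Besides the square, a term with factor t - s remains: t >= s is used here as well as for the
     sign of the weight. *)
  have -> : t * (a * a + s ^+ 2 * (b * b)) - 2 * s ^+ 2 * a * b =
    (t - s) * (a ^+ 2 + (s * b) ^+ 2) + s * (a - s * b) ^+ 2 by ring.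
  apply: addr_ge0; apply: mulr_ge0; rewrite ?sqr_ge0 ?subr_ge0 ?(ltW s0)//.
  by rewrite addr_ge0 ?sqr_ge0.
apply: le_trans (ler_wpM2l y0 h3) _.
rewrite mulrCA mulrDr; apply: le_trans (ler_wpM2l (ltW t0) (lerD h1 h2)) _.
rewrite horner_gderiv_htail_nearby /= -/s.
by rewrite le_eqVlt; apply/orP; left; apply/eqP; field.
Qed.

(** Integration by parts beyond N: the mass of phi is the integral of - (x - N) phi', which
    [hsum_drift] bounds by six tails, each at most 1. *)
Lemma sum_htail_le r : exists C : R, forall N, (0 < N)%N ->
  \sum_(j < N) (htail R r j).[Num.sqrt N%:R] * gauss_fun (Num.sqrt N%:R) <=
  C * Num.sqrt N%:R.
Proof.
exists (15 * r.+1%:R ^+ 2) => -[//|n] _; set s := Num.sqrt _.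
have s0 : 0 <= s by exact: sqrtr_ge0.
have sE : s ^+ 2 = n.+1%:R by rewrite sqr_sqrtr.
pose A := 5 * r.+1%:R ^+ 2 * s / 2.
(* The last term vanishes at s, and its derivative contains 2t [hsum], which cancels the derivative
   of the summed tails; only the drift is left. *)
pose D := A *: htail_nearby r n - \sum_(j < n.+1) htail R r j -
  ('X ^+ 2 - n.+1%:R%:P) * hsum R r n.+1.
have D_s : D.[s] = A * (htail_nearby r n).[s] - \sum_(j < n.+1) (htail R r j).[s].
  rewrite -horner_sum /D; move: (htail_nearby r n) (\sum_(j < _) _) (hsum R r n.+1).
  move=> a b h; rewrite hornerD hornerN hornerM !hornerD !hornerN hornerZ hornerXn.
  by rewrite hornerC sE subrr mul0r subr0.
have D_t t : (gderiv D).[t] = A * (gderiv (htail_nearby r n)).[t] -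
    (t ^+ 2 - n.+1%:R) * (gderiv (hsum R r n.+1)).[t].
  have e : gderiv (\sum_(j < n.+1) htail R r j) = - (2 * 'X * hsum R r n.+1).
    rewrite gderiv_sum /hsum mulr_sumr -sumrN; apply: eq_bigr => j _.
    by rewrite gderiv_htail.
  rewrite /D; move: e; move: (htail_nearby r n) (\sum_(j < _) _) (hsum R r n.+1).
  move=> a b h /(congr1 (fun p => p.[t])).
  rewrite hornerN hornerM hornerM hornerX -polyC_natr hornerC !horner_gderiv.
  move=> e; have {e}eb : b^`().[t] = 2 * t * b.[t] - 2 * t * h.[t].
    by rewrite -[LHS](subrK (2 * t * b.[t])) e; ring.
  rewrite derivB derivB derivZ derivM derivB derivXn derivC subr0 mulr2n expr1.
  rewrite !(hornerD, hornerN) !(hornerM, hornerZ) !(hornerD, hornerN) hornerC.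
  by rewrite hornerXn hornerX eb; ring.
have : 0 <= D.[s].
  apply: gauss_poly_ge0 => t st; rewrite D_t.
  have := hsum_drift r st; rewrite -/s.
  have -> : A = 5 * r.+1%:R ^+ 2 * s / 2 by [].
  move: (gderiv (hsum R r n.+1)).[t] (gderiv (htail_nearby r n)).[t] => a b.
  by rewrite mulrN !mulNr [_ * b / 2]mulrAC; lra.
rewrite D_s subr_ge0 => h.
rewrite -mulr_suml; apply: le_trans (ler_wpM2r (gauss_fun_ge0 s) h) _.
(* Six tails times 5/2 give 15. *)
have -> : 15 * r.+1%:R ^+ 2 * s = A * 6 by rewrite /A; field.
rewrite -mulrA ler_wpM2l ?divr_ge0 ?mulr_ge0 ?sqr_ge0//.
have -> : (htail_nearby r n).[s] =
    (htail R r.+1 n.+1).[s] + (htail R r.-1 n.-1).[s] + (htail R r n).[s] +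
    ((htail R r.+1 n.+2).[s] + (htail R r.-1 n).[s] + (htail R r n.+1).[s]).
  rewrite /htail_nearby; move: (htail R r.+1 n.+1) (htail R r.-1 n.-1) (htail R r n).
  move: (htail R r.+1 n.+2) (htail R r.-1 n) (htail R r n.+1) => *.
  by rewrite !hornerD.
rewrite !mulrDl; have := htail_le1 r.+1 n.+1 s0; have := htail_le1 r.-1 n.-1 s0.
have := htail_le1 r n s0; have := htail_le1 r.+1 n.+2 s0.
have := htail_le1 r.-1 n s0; have := htail_le1 r n.+1 s0; lra.
Qed.

End Bounds.

(** * Area of the disk and integration of radial functions *)

Section RadialIntegration.
Variable R : realType.
Local Notation mu := (@lebesgue_measure R).
Local Notation R1 := (measurableTypeR R).
Local Notation R2 := (measurableTypeR R * measurableTypeR R)%type.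
Implicit Types (s a x : R).

(** The square root of a negative number is 0, so empty sections are covered. *)
Lemma xsection_sqr_disk s x :
  mu (xsection [set p : R * R | p.1 ^+ 2 + p.2 ^+ 2 < s] x) =
  (2 * Num.sqrt (s - x ^+ 2))%:E.
Proof.
rewrite (_ : xsection _ x = `] - Num.sqrt (s - x ^+ 2), Num.sqrt (s - x ^+ 2)[%classic).
  rewrite lebesgue_measure_itv /= lte_fin.
  case: ltP => [_|]; first by rewrite -EFinB; congr EFin; ring.
  have := sqrtr_ge0 (s - x ^+ 2); move: (Num.sqrt _) => q q0 qle.
  by congr EFin; lra.
apply/seteqP; split => y; rewrite /xsection /= inE/= in_itv/= -ltr_norml.
  by rewrite -ltrBrDl => h; rewrite -sqrtr_sqr ltr_sqrt// (le_lt_trans (sqr_ge0 y) h).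
move=> h; have : Num.sqrt (s - x ^+ 2) != 0 by rewrite gt_eqF// (le_lt_trans _ h).
rewrite sqrtr_eq0 -ltNge => s0.
by rewrite -ltrBrDl -ltr_sqrt// sqrtr_sqr.
Qed.

(* The antiderivative [x q + 2 s atan (x / (rho + q))], [q = sqrt (s - x^2)],
   is the classical [x q + s arcsin (x / rho)], written so that its continuity
   at the endpoints is that of [atan] and the square root. *)
Lemma integral_half_chord s : 0 < s ->
  (\int[mu]_(x in `[(- Num.sqrt s)%R, Num.sqrt s]) (2 * Num.sqrt (s - x ^+ 2))%:E =
   (pi * s)%:E)%E.
Proof.
move=> s0; set rho := Num.sqrt s.
have rho0 : 0 < rho by rewrite sqrtr_gt0.
have rhoE : rho ^+ 2 = s by rewrite sqr_sqrtr// ltW.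
pose q x := Num.sqrt (s - x ^+ 2).
pose F x := x * q x + 2 * s * atan (x / (rho + q x)).
have q_ge0 x : 0 <= q x by exact: sqrtr_ge0.
have rq x : rho + q x != 0 by rewrite gt_eqF// ltr_wpDr.
have cq : continuous q.
  move=> x; apply: (@continuous_comp _ _ _ (fun x => s - x ^+ 2) (@Num.sqrt R)).
    by apply: cvgB; [exact: cvg_cst|exact: exprn_continuous].
  exact: sqrt_continuous.
have cF : continuous F.
  move=> x; apply: cvgD; first by apply: cvgM; [exact: cvg_id|exact: cq].
  apply: cvgM; first exact: cvg_cst.
  apply: (@continuous_comp _ _ _ (fun x => x / (rho + q x)) (@atan R)).
    apply: cvgM; first exact: cvg_id.
    apply: cvgV; first exact: rq.
    by apply: cvgD; [exact: cvg_cst|exact: cq].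
  exact: continuous_atan.
have dF x : x \in `]- rho, rho[ -> is_derive x 1 F (2 * q x).
  rewrite in_itv/= -ltr_norml => xr.
  have sx : 0 < s - x ^+ 2.
    by rewrite subr_gt0 -rhoE -[x ^+ 2]real_normK ?num_real// ltr_pXn2r// nnegrE ltW.
  have dq : is_derive x 1 q (- x / q x).
    have d1 : is_derive x 1 (fun x => s - x ^+ 2) (- (2 * x)).
      by apply: trigger_derive; rewrite /GRing.scale /=; ring.
    have d2 := is_derive1_sqrt sx.
    have := @is_derive1_comp R Num.sqrt (fun x => s - x ^+ 2) x _ _ d2 d1.
    move=> /trigger_derive; apply.
    by rewrite -/(q x) invfM mulrC mulrA mulNr mulrAC divff ?mul1r// mulNr.
  have q0 : q x != 0 by rewrite gt_eqF// sqrtr_gt0.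
  have x2 : x ^+ 2 = rho ^+ 2 - q x ^+ 2.
    by rewrite rhoE sqr_sqrtr ?(ltW sx)// opprB addrC subrK.
  have dr : is_derive x 1 (fun x => rho + q x) (- x / q x).
    rewrite -[X in is_derive _ _ _ X]add0r.
    exact: (is_deriveD (is_derive_cst rho x 1) dq).
  have di := @is_deriveV R (fun x => rho + q x) x _ 1 (rq x) dr.
  have dw : is_derive x 1 (fun x => x / (rho + q x)) (rho / (q x * (rho + q x))).
    apply: trigger_derive; rewrite /GRing.scale /=.
    transitivity ((q x * (rho + q x) + x ^+ 2) / (q x * (rho + q x) ^+ 2)).
      by field; rewrite q0 rq.
    by rewrite x2; field; rewrite q0 rq.
  have da := is_derive1_atan (x / (rho + q x)).
  have dc := @is_derive1_comp R (@atan R) (fun x => x / (rho + q x)) x _ _ da dw.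
  (* Since x^2 + q^2 = rho^2, the denominator from atan loses its square. *)
  have e1 : 1 + (x / (rho + q x)) ^+ 2 = 2 * rho / (rho + q x).
    by rewrite expr_div_n x2; field; rewrite rq.
  rewrite e1 in dc.
  rewrite /F; apply: trigger_derive; rewrite /GRing.scale /=.
  rewrite -rhoE; transitivity (q x + (rho ^+ 2 - x ^+ 2) / q x).
    by field; rewrite q0 rq gt_eqF.
  by rewrite x2; field.
rewrite (@continuous_FTC2 R (fun x => 2 * q x) F) //.
(* At the endpoints q = 0 and atan is taken at 1 and -1, so F grows by 2s times pi / 2. *)
- rewrite -EFinB; congr EFin; rewrite /F /q sqrrN rhoE subrr sqrtr0 !addr0 !mulr0.
  by rewrite !add0r mulNr divff ?gt_eqF// atanN atan1; field.
- by rewrite gtrN.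
- apply: continuous_subspaceT => x.
  by apply: cvgM; [exact: cvg_cst|exact: cq].
- split.
  + by move=> x /dF dFx; exact: ex_derive.
  + by apply: cvg_at_right_filter; exact: cF.
  + by apply: cvg_at_left_filter; exact: cF.
- by move=> x /dF dFx; rewrite derive1E; exact: derive_val.
Qed.

(* [leb2], which carries no canonical measure structure. *)
Definition lam2 : {measure set R2 -> \bar R} := (mu \x mu)%E.

Lemma lam2_sqr_disk s : 0 < s ->
  lam2 [set p : R * R | p.1 ^+ 2 + p.2 ^+ 2 < s] = (pi * s)%:E.
Proof.
move=> s0; pose D := [set p : R * R | p.1 ^+ 2 + p.2 ^+ 2 < s].
transitivity (\int[mu]_x mu (xsection D x))%E; first by [].
under eq_integral do rewrite xsection_sqr_disk.
rewrite -(integral_half_chord s0) [RHS]integral_mkcond; apply: eq_integral => x _.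
rewrite patchE; case: ifPn => // /negP xN.
rewrite ler0_sqrtr ?mulr0// subr_le0 leNgt; apply/negP => xs; apply: xN.
rewrite inE/= in_itv/= -ler_norml -sqrtr_sqr ler_wsqrtr// ltW//.
Qed.

Lemma sqr_disk0 s : s <= 0 -> [set p : R * R | p.1 ^+ 2 + p.2 ^+ 2 < s] = set0.
Proof.
move=> s0; rewrite -subset0 => p /= h.
have := lt_le_trans h s0; rewrite ltNge => /negP; apply.
by rewrite addr_ge0 ?sqr_ge0.
Qed.

Lemma measurable_radius2 a : measurable_fun (setT : set R2)
  (fun p : R2 => (a : R1) * (p.1 ^+ 2 + p.2 ^+ 2)).
Proof.
by apply: measurable_funM => //; apply: measurable_funD; apply: measurable_funX.
Qed.

(** By the area of disks the two measures agree on the half-lines ]-oo, s[, which are stable under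
    intersection and generate the Borel sets; their finiteness on ]-oo, k[ gives uniqueness. *)
Lemma pushforward_radius2 a (a0 : 0 < a) A : measurable A ->
  pushforward lam2 (fun p : R * R => a * (p.1 ^+ 2 + p.2 ^+ 2)) A =
  ((pi / a)%:E * mu (A `&` `[0%R, +oo[))%E.
Proof.
move=> mA.
have k0 : 0 <= pi / a :> R by rewrite divr_ge0 ?pi_ge0 ?ltW.
pose phi : R2 -> R1 := fun p => a * (p.1 ^+ 2 + p.2 ^+ 2).
have mphi : measurable_fun (setT : set R2) phi by exact: measurable_radius2.
have mI : measurable (`[0%R, +oo[%classic : set R) by exact: measurable_itv.
have E s : lam2 (phi @^-1` `]-oo, s[) =
    ((pi / a)%:E * mu (`]-oo, s[ `&` `[0%R, +oo[))%E.
  have -> : phi @^-1` `]-oo, s[ = [set p : R * R | p.1 ^+ 2 + p.2 ^+ 2 < s / a].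
    by apply/seteqP; split => p; rewrite /= in_itv/= /phi ltr_pdivlMr// mulrC.
  case: (ltP 0 s) => s0.
    rewrite lam2_sqr_disk ?divr_gt0// (_ : _ `&` _ = `[0, s[%classic).
      by rewrite lebesgue_measure_itv/= lte_fin s0 -EFinB -EFinM subr0 mulrAC mulrA.
    apply/seteqP; split => x /=; rewrite !in_itv/= ?andbT; first by move=> [-> ->].
    by move=> /andP[-> ->].
  rewrite sqr_disk0 ?measure0; last by rewrite mulr_le0_ge0// invr_ge0 ltW.
  rewrite (_ : _ `&` _ = set0) ?measure0 ?mule0//.
  rewrite -subset0 => x /=; rewrite !in_itv/= andbT => -[xs x0].
  by have := le_lt_trans x0 (lt_le_trans xs s0); rewrite ltxx.
pose m1 := measure_function_pushforward__canonical__measure_function_Measure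
  lam2 mphi.
pose m2 : {measure set R1 -> \bar R} := mscale (NngNum k0) (mrestr mu mI).
change (m1 A = m2 A).
refine (@measure_unique _ R R1 (@RGenInftyO.G R)
  (fun k => `]-oo, k%:R[%classic) _ _ _ _ m1 m2 _ _ A mA).
- exact: RGenInftyO.measurableE.
- move=> _ _ [x ->] [y ->]; exists (Num.min x y).
  by apply/seteqP; split => z /=; rewrite !in_itv/= lt_min => /andP.
- by move=> k; exists k%:R.
- rewrite -subTset => x _; exists (Num.bound `|x|) => //=.
  rewrite in_itv/=; apply: le_lt_trans (ler_norm x) _.
  by apply: archi_boundP; exact: normr_ge0.
- by move=> _ [x ->]; exact: E.
- move=> k; rewrite [m1 _]E; apply: lte_mul_pinfty; rewrite ?lee_fin//.
  apply: (@le_lt_trans _ _ (mu `[0%R, k%:R])%E).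
    apply: le_measure; rewrite ?inE//=; first exact: measurableI.
    by move=> x /=; rewrite !in_itv/= andbT => -[/ltW -> ->].
  by rewrite lebesgue_measure_itv/=; case: ifP => _; rewrite -?EFinB ltry.
Qed.

Lemma integral_radial a (G : R -> \bar R) : 0 < a ->
  measurable_fun setT G -> (forall x, 0 <= G x)%E ->
  (\int[@leb2 R]_(p in setT) G (a * (p.1 ^+ 2 + p.2 ^+ 2))%R =
   (pi / a)%:E * \int[mu]_(x in `[0%R, +oo[) G x)%E.
Proof.
move=> a0 mG G0.
pose phi : R2 -> R1 := fun p => a * (p.1 ^+ 2 + p.2 ^+ 2).
have mphi : measurable_fun (setT : set R2) phi by exact: measurable_radius2.
have k0 : 0 <= pi / a :> R by rewrite divr_ge0 ?pi_ge0 ?ltW.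
have mI : measurable (`[0%R, +oo[%classic : set R) by exact: measurable_itv.
have mGI : measurable_fun (`[0%R, +oo[%classic : set R) G by exact: measurable_funTS.
have := @ge0_integral_pushforward _ _ _ _ _ _ mphi lam2 `[0, +oo[ G mI mGI
  (fun x _ => G0 x).
have -> : phi @^-1` `[0, +oo[ = setT.
  rewrite -subTset => p _; rewrite /= in_itv/= andbT /phi mulr_ge0 ?(ltW a0)//.
  by rewrite addr_ge0 ?sqr_ge0.
move=> <-; rewrite -(ge0_integral_mscale mu mI (NngNum k0))//.
apply: eq_measure_integral => A mA AI.
rewrite [LHS](pushforward_radius2 a0 mA) /mscale/=.
by rewrite setIidl.
Qed.

End RadialIntegration.

(** * The intensity on the half-line and its distance to an indicator *)

Section OneDimensional.
Variable R : realType.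
Local Notation mu := (@lebesgue_measure R).
Implicit Types (r N : nat) (x : R).

(* The one-point intensity as a function of [x = pi |z|^2]. *)
Definition intensity r N x : R :=
  (hsum R r N).[Num.sqrt x] * gauss_fun (Num.sqrt x).

Definition tail_mass r N x : R :=
  \sum_(j < N) (htail R r j).[Num.sqrt x] * gauss_fun (Num.sqrt x).

Lemma continuous_gauss_poly_sqrt (p : {poly R}) :
  continuous (fun x => p.[Num.sqrt x] * gauss_fun (Num.sqrt x)).
Proof.
move=> x; apply: (@continuous_comp _ _ _ (@Num.sqrt R) (fun t => p.[t] * gauss_fun t)).
  exact: sqrt_continuous.
by apply: cvgM; [exact: continuous_horner|exact: continuous_gauss_fun].
Qed.

Lemma tail_massE r N : tail_mass r N =
  (fun x => (\sum_(j < N) htail R r j).[Num.sqrt x] * gauss_fun (Num.sqrt x)).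
Proof. by apply/funext => x; rewrite horner_sum mulr_suml. Qed.

Lemma continuous_tail_mass r N : continuous (tail_mass r N).
Proof. by rewrite tail_massE; exact: continuous_gauss_poly_sqrt. Qed.

Lemma continuous_intensity r N : continuous (intensity r N).
Proof. exact: continuous_gauss_poly_sqrt. Qed.

Lemma intensity_ge0 r N x : 0 <= intensity r N x.
Proof. exact: phi_ge0. Qed.

Lemma intensity_le1 r N x : intensity r N x <= 1.
Proof. exact: phi_le1. Qed.

Lemma is_derive_tail_mass r N x : 0 < x ->
  is_derive x 1 (tail_mass r N) (- intensity r N x).
Proof.
move=> x0; rewrite tail_massE.
have d1 := is_derive1_sqrt x0.
have d2 := is_derive_gauss_poly (\sum_(j < N) htail R r j) (Num.sqrt x).
have := @is_derive1_comp R (fun t => (\sum_(j < N) htail R r j).[t] * gauss_fun t)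
  Num.sqrt x _ _ d2 d1.
move=> /trigger_derive; apply.
have -> : (gderiv (\sum_(j < N) htail R r j)).[Num.sqrt x] =
   - (2 * Num.sqrt x * (hsum R r N).[Num.sqrt x]).
  rewrite gderiv_sum !horner_sum mulr_sumr -sumrN; apply: eq_bigr => j _.
  by rewrite horner_gderiv_htail.
rewrite /intensity; have : Num.sqrt x != 0 by rewrite gt_eqF// sqrtr_gt0.
move: (Num.sqrt x) => s s0.
by field.
Qed.

Lemma tail_mass0 r N : tail_mass r N 0 = N%:R.
Proof.
rewrite /tail_mass sqrtr0 (eq_bigr (fun=> 1)) ?sumr_const ?card_ord// => j _.
by rewrite htail0 /gauss_fun expr0n oppr0 expR0 mulr1.
Qed.

Lemma cvg_tail_mass r N : tail_mass r N x @[x --> +oo] --> (0 : R).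
Proof.
rewrite tail_massE.
apply: (cvg_comp (@Num.sqrt R) (fun t => (\sum_(j < N) htail R r j).[t] * gauss_fun t)).
  apply/cvgryPge => A; near=> x.
  apply: (le_trans (ler_norm A)); rewrite -sqrtr_sqr ler_wsqrtr//.
exact: cvg_gauss_poly.
Unshelve. all: by end_near. Qed.

Lemma integral_intensity_tail r N :
  (\int[mu]_(x in `[N%:R, +oo[) (intensity r N x)%:E = (tail_mass r N N%:R)%:E)%E.
Proof.
rewrite (@ge0_continuous_FTC2y R (intensity r N) (fun x => - tail_mass r N x) N%:R 0).
- by rewrite sub0e EFinN oppeK.
- by move=> x _; exact: intensity_ge0.
- by apply: continuous_subspaceT; exact: continuous_intensity.
- by rewrite -[X in _ --> X]oppr0; apply: cvgN; exact: cvg_tail_mass.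
- move=> x Nx; have x0 : 0 < x by exact: le_lt_trans Nx.
  have := is_derive_tail_mass r N x0 => d.
  exact: ex_derive.
- by apply: cvg_at_right_filter; apply: cvgN; exact: continuous_tail_mass.
- move=> x; rewrite in_itv/= andbT => Nx; have x0 : 0 < x by exact: le_lt_trans Nx.
  have := is_derive_tail_mass r N x0 => d.
  by rewrite derive1E derive_val opprK.
Qed.

(** The total mass is N ([tail_mass0]), so what is missing on [0, N] equals what lies beyond N. *)
Lemma integral_intensity_deficit r N : (0 < N)%N ->
  (\int[mu]_(x in `[0%R, N%:R]) (1 - intensity r N x)%:E = (tail_mass r N N%:R)%:E)%E.
Proof.
move=> N0; have NR : 0 < N%:R :> R by rewrite ltr0n.
have cF : continuous (fun x => x + tail_mass r N x).
  by move=> x; apply: cvgD; [exact: cvg_id|exact: continuous_tail_mass].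
have dF x : 0 < x -> is_derive x 1 (fun x => x + tail_mass r N x) (1 - intensity r N x).
  by move=> x0; have d := is_derive_tail_mass r N x0; exact: is_deriveD.
rewrite (@continuous_FTC2 R (fun x => 1 - intensity r N x)
  (fun x => x + tail_mass r N x))//.
- by rewrite tail_mass0 add0r EFinD -addeAC subee ?add0e.
- apply: continuous_subspaceT => x; apply: cvgB; first exact: cvg_cst.
  exact: continuous_intensity.
- split.
  + move=> x; rewrite in_itv/= => /andP[x0 _]; have d := dF _ x0.
    exact: ex_derive.
  + by apply: cvg_at_right_filter; exact: cF.
  + by apply: cvg_at_left_filter; exact: cF.
- move=> x; rewrite in_itv/= => /andP[x0 _]; have d := dF _ x0.
  by rewrite derive1E; exact: derive_val.
Qed.

Lemma measurable_intensity_dist r N (c : R) :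
  measurable_fun setT (fun x : R => `|intensity r N x - (x < c)%R%:R|%R%:E).
Proof.
apply/measurable_EFinP; apply: measurableT_comp => //; apply: measurable_funB => //.
  by apply: continuous_measurable_fun; exact: continuous_intensity.
rewrite (_ : (fun x => _) = \1_(`]-oo, (c : R)[%classic)); last first.
  by apply/funext => x; rewrite indicE mem_setE/= in_itv.
exact: measurable_indic.
Qed.

(** As the intensity lies in [0, 1], the absolute value has a known sign on each side of N; deficit
    and excess are equal. *)
Lemma integral_intensity_dist r N : (0 < N)%N ->
  (\int[mu]_(x in `[0%R, +oo[) `|intensity r N x - (x < N%:R)%R%:R|%R%:E =
   (2 * tail_mass r N N%:R)%:E)%E.
Proof.
move=> N0; have NR : 0 < N%:R :> R by rewrite ltr0n.
have mI : measurable_fun setT (intensity r N).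
  by apply: continuous_measurable_fun; exact: continuous_intensity.
have mD := measurable_intensity_dist r N N%:R.
rewrite (_ : `[0%R, +oo[%classic = `[0%R, N%:R[ `|` `[N%:R, +oo[); last first.
  by rewrite -itv_bndbnd_setU// bnd_simp ltW.
rewrite ge0_integral_setU//=; [|exact: measurable_funTS|]; last first.
  apply/disj_setPS => x [] /=; rewrite !in_itv/= andbT => /andP[_ h1] h2.
  by have := lt_le_trans h1 h2; rewrite ltxx.
rewrite mulr_natl mulr2n EFinD; congr (_ + _)%E.
  rewrite -integral_intensity_deficit// -[RHS]integral_itv_bndo_bndc; last first.
    apply: measurable_funTS; apply/measurable_EFinP.
    by apply: measurable_funB => //; exact: measurable_cst.
  apply: eq_integral => x; rewrite inE/= in_itv/= => /andP[_ ->].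
  by rewrite distrC ger0_norm// subr_ge0; exact: intensity_le1.
rewrite -integral_intensity_tail; apply: eq_integral => x.
rewrite inE/= in_itv/= andbT => Nx; rewrite ltNge Nx subr0 ger0_norm//.
exact: intensity_ge0.
Qed.

End OneDimensional.

(** * From complex Hermite polynomials to the densities *)

Section OnePointIntensity.
Variable R : realType.
Implicit Types (r j N a : nat) (z : R[i]) (t : R).

Lemma horner_hcoef_laguerre_le r j t : (j <= r)%N ->
  (hcoef R r j).[t] = (- t) ^+ (r - j) * laguerre j (r - j) (t ^+ 2).
Proof.
move=> jr; rewrite /hcoef /laguerre horner_sum mulr_sumr; apply: eq_bigr => i _.
rewrite hornerZ hornerM horner_exp hornerN hornerX hornerXn subnKC//.
have -> : (r - (j - i) = (r - j) + i)%N by have := ltn_ord i; lia.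
rewrite exprD [(- t) ^+ i]exprNn expr2 exprMn.
by ring.
Qed.

Lemma horner_hcoef_laguerre_ge r j t : (r <= j)%N ->
  j`!%:R * (hcoef R r j).[t] = r`!%:R * (t ^+ (j - r) * laguerre r (j - r) (t ^+ 2)).
Proof.
move=> rj; rewrite /hcoef /laguerre horner_sum !mulr_sumr.
rewrite -(big_mkord xpredT (fun i => j`!%:R * (('C(r, j - i)%:R / i`!%:R) *:
   ((- 'X) ^+ (r - (j - i)) * 'X^i)).[t])).
(* The terms with i < j - r vanish, their binomial being 0; the others are reindexed by i - (j -
   r). *)
rewrite (big_cat_nat _ (n := j - r)) ?leq0n//=; last by lia.
rewrite big_nat_cond big1 ?add0r; last first.
  move=> i /andP[/andP[_ ij] _]; rewrite bin_small ?mul0r ?scale0r ?horner0 ?mulr0//.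
  by lia.
rewrite -{1}[(j - r)%N]add0n big_addn (_ : (j.+1 - (j - r) = r.+1)%N); last by lia.
rewrite big_mkord; apply: eq_bigr => -[i /= ir] _.
rewrite hornerZ hornerM horner_exp hornerN hornerX hornerXn subnKC//.
have -> : (j - (i + (j - r)) = r - i)%N by lia.
have -> : (r - (r - i) = i)%N by lia.
have -> : (i + (j - r) = (j - r) + i)%N by lia.
rewrite exprD [(- t) ^+ i]exprNn [t ^+ 2]expr2 exprMn.
have e : j`!%:R * ('C(r, r - i)%:R / ((j - r) + i)`!%:R) =
   r`!%:R * ('C(j, r - i)%:R / i`!%:R) :> R.
  have n0 k : k`!%:R != 0 :> R by rewrite pnatr_eq0 -lt0n fact_gt0.
  have e1 : 'C(r, r - i)%:R * ((r - i)`!%:R * i`!%:R) = r`!%:R :> R.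
    by rewrite -!natrM -(bin_fact (leq_subr i r)) subKn.
  have e2 : 'C(j, r - i)%:R * ((r - i)`!%:R * ((j - r) + i)`!%:R) = j`!%:R :> R.
    rewrite -!natrM -(@bin_fact j (r - i)); last by lia.
    by rewrite (_ : (j - (r - i) = (j - r) + i)%N)//; lia.
  rewrite -e1 -e2; field.
  by rewrite !n0.
rewrite mulrA e; ring.
Qed.

Lemma sqr_normc_realC (x : R) (w : R[i]) :
  (x%:C * w * (x%:C * w)^* = (x ^+ 2)%:C * (w * w^*))%C.
Proof.
case: w => a b; apply/eqP; rewrite eq_complex /=.
by apply/andP; split; apply/eqP; ring.
Qed.

Lemma mulc_conjX z n : (z ^+ n * (z ^+ n)^* = ((sqnorm z) ^+ n)%:C)%C.
Proof.
rewrite rmorphXn -exprMn rmorphXn; congr (_ ^+ _).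
case: z => a b; rewrite /sqnorm; apply/eqP; rewrite eq_complex /=.
by apply/andP; split; apply/eqP; ring.
Qed.

(** In both branches the phase and the sign drop out, and pi^k |z|^{2k} becomes t^{2k} with k = |j -
    r|. *)
Lemma cHermite_sqr r j z : (cHermite j r z * (cHermite j r z)^* =
  ((hdens R r j).[Num.sqrt (pi * sqnorm z)])%:C)%C.
Proof.
have q0 : 0 <= sqnorm z by rewrite addr_ge0 ?sqr_ge0.
have p0 : 0 <= pi :> R by exact: pi_ge0.
have x0 : 0 <= pi * sqnorm z by rewrite mulr_ge0.
set t := Num.sqrt _; have tE : t ^+ 2 = pi * sqnorm z by rewrite sqr_sqrtr.
have n0 k : k`!%:R != 0 :> R by rewrite pnatr_eq0 -lt0n fact_gt0.
have f0 k l : 0 <= k`!%:R / l`!%:R :> R by rewrite divr_ge0.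
rewrite /hdens hornerZ horner_exp /cHermite; case: ifPn => [rj|].
  have := horner_hcoef_laguerre_ge t (ltnW rj); rewrite tE => e.
  rewrite sqr_normc_realC mulc_conjX -rmorphM; congr (_%:C)%C.
  rewrite !exprMn sqr_sqrtr// -exprM mulnC exprM sqr_sqrtr//.
  have -> : (hcoef R r j).[t] = r`!%:R / j`!%:R *
      (t ^+ (j - r) * laguerre r (j - r) (pi * sqnorm z)).
    by rewrite mulrAC -e mulrAC mulfV ?mul1r.
  rewrite !exprMn -exprM [(_ * 2)%N]mulnC exprM tE exprMn expr2.
  by field; rewrite !n0.
rewrite -leqNgt => jr.
rewrite sqr_normc_realC horner_hcoef_laguerre_le// tE.
have qz : sqnorm (conjc z) = sqnorm z by case: (z) => x y; rewrite /sqnorm /= sqrrN.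
rewrite mulc_conjX qz.
rewrite -rmorphM; congr (_%:C)%C.
rewrite !exprMn sqr_sqrtr// -!exprM [(_ * 2)%N]mulnC !exprM sqr_sqrtr// !sqrrN tE.
rewrite !expr1n.
by rewrite exprMn; ring.
Qed.

Lemma rho_rNE r N z : rho_rN r N z = intensity r N (pi * sqnorm z).
Proof.
have x0 : 0 <= pi * sqnorm z by rewrite mulr_ge0 ?pi_ge0 ?addr_ge0 ?sqr_ge0.
rewrite /rho_rN /K_rN (eq_bigr _ (fun (j : 'I_N) _ => cHermite_sqr r j z)).
rewrite -rmorph_sum -rmorphM /= /intensity /hsum horner_sum mulrC; congr (_ * _).
rewrite /gauss_fun sqr_sqrtr//; congr expR.
by field.
Qed.

Lemma sqnorm_toC (p : R * R) : sqnorm (toC p) = p.1 ^+ 2 + p.2 ^+ 2.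
Proof. by []. Qed.

Lemma tail_mass_le r : exists C : R, 0 <= C /\
  forall N, tail_mass (R:=R) r N N%:R <= C * Num.sqrt N%:R.
Proof.
have [C HC] := sum_htail_le R r; exists `|C|; split => // -[|N].
  by rewrite /tail_mass big_ord0 sqrtr0 mulr0.
by apply: le_trans (HC N.+1 isT) _; rewrite ler_wpM2r ?sqrtr_ge0 ?ler_norm.
Qed.

Lemma integral_rho_dist r N (a : R) : (0 < N)%N -> 0 < a ->
  (\int[@leb2 R]_(p in setT) `|intensity r N (a * (p.1 ^+ 2 + p.2 ^+ 2)) -
     (a * (p.1 ^+ 2 + p.2 ^+ 2) < N%:R)%R%:R|%R%:E =
   (pi / a * (2 * tail_mass (R:=R) r N N%:R))%:E)%E.
Proof.
move=> N0 a0.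
rewrite (integral_radial (G := fun x => `|intensity r N x - (x < N%:R)%R%:R|%R%:E))//.
  by rewrite integral_intensity_dist// -EFinM.
exact: measurable_intensity_dist.
Qed.

End OnePointIntensity.

(** * The rate and the convergence in the plane *)

Unset Implicit Arguments.

Theorem theorem1p1 (R : realType) (r : nat) (hr : (0 < r)%N) :
  ((fun N : nat =>
      (\int[@leb2 R]_(p in setT)
         (`| rho_rN r N (toC ((Num.sqrt (N%:R / pi) * p.1, Num.sqrt (N%:R / pi) * p.2)))
             - \1_(disk 1) p |)%:E)%E)
     @ \oo --> 0%E)
  /\
  (exists C : R, forall N : nat,
      (\int[@leb2 R]_(p in setT)
         (`| rho_rN r N (toC p) - \1_(disk (Num.sqrt (N%:R / pi))) p |)%:E
       <= (C * Num.sqrt N%:R)%:E)%E).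
Proof.
have pi0 : 0 < pi :> R by exact: pi_gt0.
have [C [C0 HC]] := tail_mass_le R r.
have NR N : (0 < N)%N -> 0 < N%:R :> R by rewrite ltr0n.
have indE (s : R) (p : R * R) : \1_(disk s) p = (p.1 ^+ 2 + p.2 ^+ 2 < s ^+ 2)%R%:R :> R.
  by rewrite indicE mem_setE.
split; last first.
  exists (2 * C) => -[|N].
    (* For N = 0 the disk has radius 0 and is empty, as is the sum. *)
    rewrite (eq_integral (fun=> 0%E)); first by rewrite integral0 sqrtr0 mulr0.
    move=> p _; rewrite indE mul0r sqrtr0 expr0n /= ltNge addr_ge0 ?sqr_ge0//=.
    by rewrite rho_rNE /intensity /hsum big_ord0 horner0 mul0r subrr normr0.
  (* Here a = pi, so the Jacobian factor pi / a is 1. *)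
  rewrite [leLHS](_ : _ = (pi / pi * (2 * tail_mass r N.+1 N.+1%:R))%:E); last first.
    rewrite -integral_rho_dist//; apply: eq_integral => p _.
    rewrite indE rho_rNE sqnorm_toC sqr_sqrtr ?divr_ge0 ?(ltW pi0)//.
    by rewrite ltr_pdivlMr// [_ * pi]mulrC.
  by rewrite lee_fin divff ?gt_eqF// mul1r -mulrA ler_pM2l.
(* After the dilation the variable is x = N |p|^2: the unit disk is x < N and the Jacobian factor is
   pi / N. *)
have bound N : (0 < N)%N ->
  (\int[@leb2 R]_(p in setT)
     (`| rho_rN r N (toC ((Num.sqrt (N%:R / pi) * p.1, Num.sqrt (N%:R / pi) * p.2)))
         - \1_(disk 1) p |)%:E = (pi / N%:R * (2 * tail_mass r N N%:R))%:E)%E.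
  move=> N0; rewrite -integral_rho_dist ?NR//; apply: eq_integral => p _.
  have e : pi * sqnorm (toC (Num.sqrt (N%:R / pi) * p.1, Num.sqrt (N%:R / pi) * p.2)) =
      N%:R * (p.1 ^+ 2 + p.2 ^+ 2) :> R.
    rewrite sqnorm_toC /= !exprMn -mulrDr sqr_sqrtr ?divr_ge0 ?(ltW pi0)//.
    by rewrite mulrA [pi * _]mulrC divfK// gt_eqF.
  rewrite indE rho_rNE e expr1n.
  by rewrite gtr_pMr ?NR.
(* The upper bound is pi / N times 2 C sqrt N. *)
apply: (@squeeze_cvge _ _ _ _ (fun=> 0%E) _
  (fun N => (2 * pi * C * (Num.sqrt N%:R)^-1)%:E)).
- near=> N; have N0 : (0 < N)%N by near: N; exact: nbhs_infty_gt.
  have sN : 0 < Num.sqrt N%:R :> R by rewrite sqrtr_gt0 NR.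
  rewrite bound// !lee_fin mulr_ge0 ?divr_ge0 ?(ltW pi0)//=; last first.
    rewrite mulr_ge0// /tail_mass sumr_ge0// => j _.
    by rewrite mulr_ge0 ?gauss_fun_ge0 ?htail_ge0 ?sqrtr_ge0.
  apply: (@le_trans _ _ (pi / N%:R * (2 * (C * Num.sqrt N%:R)))).
    by rewrite ler_wpM2l ?divr_ge0 ?(ltW pi0)// ler_pM2l.
  rewrite -{1}[N%:R]sqr_sqrtr//; move: sN; move: (Num.sqrt N%:R) => s s0.
  by rewrite le_eqVlt; apply/orP; left; apply/eqP; field; rewrite gt_eqF.
- exact: cvg_cst.
- apply: cvg_EFin; first by near=> N.
  rewrite -(mulr0 (2 * pi * C)); apply: cvgM; first exact: cvg_cst.
  apply/gtr0_cvgV0.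
    by near=> N; rewrite sqrtr_gt0 NR//; near: N; exact: nbhs_infty_gt.
  apply/cvgryPge => A; near=> N.
  apply: (le_trans (ler_norm A)); rewrite -sqrtr_sqr ler_wsqrtr//.
  by near: N; exact: nbhs_infty_ger.
Unshelve. all: by end_near. Qed.
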